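(* Let $R$ be a ring and $M$ a right $R$-module, and consider the following conditions: (1) $M$ is a quasi-duo endoregular module and $M$ is a subdirect product of simple modules. (2) $M$ is an abelian endoregular module and $\operatorname{Rad}(M)=0$. Then (1) implies (2). If $M$ is $M^{(\mathcal I)}$-projective for every index set $\mathcal I$, then the two conditions are equivalent.
   Context: Rings are associative with identity and modules are unitary right modules. A ring $S$ is von Neumann regular if for every $s\in S$ there is $x\in S$ with $sxs=s$; it is abelian if every idempotent of $S$ is central. A module $M$ is endoregular if $\operatorname{End}_R(M)$ is von Neumann regular, and abelian endoregular if $\operatorname{End}_R(M)$ is abelian von Neumann regular. A submodule $N$ of $M$ is fully invariant if $\varphi(N)\subseteq N$ for all $\varphi\in\operatorname{End}_R(M)$; $M$ is quasi-duo if every maximal submodule is fully invariant. $M$ is a subdirect product of a family $\{N_i\}_{i\in\mathcal J}$ if $M$ is (isomorphic to) a submodule of $\prod_{i\in\mathcal J} N_i$ such that every canonical projection restricted to $M$ is surjective. $\operatorname{Rad}(M)$ is the intersection of all maximal submodules of $M$ (equal to $M$ if there are none). $M$ is $L$-projective if for every epimorphism $\pi:L\to N$ and every homomorphism $f:M\to N$ there is $g:M\to L$ with $\pi g=f$. $M^{(\mathcal I)}$ is the direct sum of $|\mathcal I|$ copies of $M$. *)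

(* Defs.v *)
From HB Require Import structures.
From mathcomp Require Import all_boot all_order all_algebra.
From mathcomp Require Import boolp classical_sets functions cardinality.

Set Implicit Arguments.
Unset Strict Implicit.
Unset Printing Implicit Defensive.

Import GRing.Theory.
Local Open Scope ring_scope.
Local Open Scope classical_set_scope.

(* [pzRingType] is used throughout because the zero ring is a ring here (e.g.
   it is the endomorphism ring of the zero module). A right R-module is a left
   module over the converse ring R^c: [a *: x] for [a : R^c] is "x a". *)
Notation rmodType R := (lmodType (R^c)).

Definition von_neumann_regular (S : pzRingType) : Prop :=
  forall s : S, exists x : S, s * x * s = s.

Definition idempotent_elt (S : pzRingType) (e : S) : Prop := e * e = e.

Definition central_elt (S : pzRingType) (e : S) : Prop :=
  forall s : S, e * s = s * e.

Definition abelian_ring (S : pzRingType) : Prop :=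
  forall e : S, idempotent_elt e -> central_elt e.

Definition endring (R : pzRingType) (M : lmodType R) : Type := {linear M -> M}.

Section EndRing.
Variables (R : pzRingType) (M : lmodType R).
Local Notation E := (endring M).

HB.instance Definition _ := gen_eqMixin E.
HB.instance Definition _ := gen_choiceMixin E.

Lemma endring_ext (f g : E) :
  (f : {linear M -> M}) =1 (g : {linear M -> M}) -> f = g.
Proof.
case: f g => [f cf] [g cg] /= /funext efg; subst g.
case: cf cg => [[a] [b]] [[c] [d]].
by rewrite (Prop_irrelevance a c) (Prop_irrelevance b d).
Qed.

Definition end_zero : E := (\0 : {linear M -> M}).
Definition end_one : E := (idfun : {linear M -> M}).
Definition end_opp (f : E) : E :=
  (GRing.opp_fun (f : {linear M -> M}) : {linear M -> M}).
Definition end_add (f g : E) : E :=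
  ((f : {linear M -> M}) \+ (g : {linear M -> M}) : {linear M -> M}).
Definition end_mul (f g : E) : E :=
  ((f : {linear M -> M}) \o (g : {linear M -> M}) : {linear M -> M}).

Lemma end_addA : associative end_add.
Proof. by move=> f g h; apply: endring_ext => x /=; rewrite addrA. Qed.
Lemma end_addC : commutative end_add.
Proof. by move=> f g; apply: endring_ext => x /=; rewrite addrC. Qed.
Lemma end_add0 : left_id end_zero end_add.
Proof. by move=> f; apply: endring_ext => x /=; rewrite add0r. Qed.
Lemma end_addN : left_inverse end_zero end_opp end_add.
Proof. by move=> f; apply: endring_ext => x /=; rewrite addNr. Qed.

HB.instance Definition _ :=
  GRing.isZmodule.Build E end_addA end_addC end_add0 end_addN.

Lemma end_mulA : associative end_mul.
Proof. by move=> f g h; apply: endring_ext. Qed.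
Lemma end_mul1 : left_id end_one end_mul.
Proof. by move=> f; apply: endring_ext. Qed.
Lemma end_mulr1 : right_id end_one end_mul.
Proof. by move=> f; apply: endring_ext. Qed.
Lemma end_mulDl : left_distributive end_mul +%R.
Proof. by move=> f g h; apply: endring_ext. Qed.
Lemma end_mulDr : right_distributive end_mul +%R.
Proof. by move=> f g h; apply: endring_ext => x /=; rewrite raddfD. Qed.

HB.instance Definition _ := GRing.Zmodule_isPzRing.Build E
  end_mulA end_mul1 end_mulr1 end_mulDl end_mulDr.
End EndRing.

Definition endoregular (R : pzRingType) (M : lmodType R) : Prop :=
  von_neumann_regular (endring M).

Definition abelian_endoregular (R : pzRingType) (M : lmodType R) : Prop :=
  abelian_ring (endring M) /\ von_neumann_regular (endring M).

Section Submodules.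
Variables (R : pzRingType) (M : lmodType R).
Implicit Types N K : set M.

Definition submodule N : Prop := submod_closed [in N].

Definition fully_invariant N : Prop :=
  forall phi : {linear M -> M}, phi @` N `<=` N.

Definition maximal_submodule K : Prop :=
  [/\ submodule K, K <> setT
    & forall N, submodule N -> K `<=` N -> N = K \/ N = setT].

Definition quasi_duo : Prop :=
  forall K, maximal_submodule K -> fully_invariant K.

(* The intersection of the empty family is [setT], i.e. the whole of M. *)
Definition Rad : set M := \bigcap_(K in maximal_submodule) K.

Definition simple_module : Prop :=
  (exists x : M, x != 0) /\
  forall N, submodule N -> N = [set 0] \/ N = setT.
End Submodules.

Arguments quasi_duo {R} M.
Arguments Rad {R} M.
Arguments simple_module {R} M.

Definition mod_prod (R : pzRingType) (I : Type) (N : I -> lmodType R) : Type :=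
  forall i, N i.

Section ModProd.
Variables (R : pzRingType) (I : Type) (N : I -> lmodType R).
Local Notation P := (mod_prod N).

HB.instance Definition _ := gen_eqMixin P.
HB.instance Definition _ := gen_choiceMixin P.

Definition prod_zero : P := fun i => 0.
Definition prod_opp (f : P) : P := fun i => - f i.
Definition prod_add (f g : P) : P := fun i => f i + g i.
Definition prod_scale (a : R) (f : P) : P := fun i => a *: f i.

Lemma prod_addA : associative prod_add.
Proof. by move=> f g h; apply: functional_extensionality_dep => i; apply: addrA. Qed.
Lemma prod_addC : commutative prod_add.
Proof. by move=> f g; apply: functional_extensionality_dep => i; apply: addrC. Qed.
Lemma prod_add0 : left_id prod_zero prod_add.
Proof. by move=> f; apply: functional_extensionality_dep => i; apply: add0r. Qed.
Lemma prod_addN : left_inverse prod_zero prod_opp prod_add.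
Proof. by move=> f; apply: functional_extensionality_dep => i; apply: addNr. Qed.

HB.instance Definition _ :=
  GRing.isZmodule.Build P prod_addA prod_addC prod_add0 prod_addN.

Lemma prod_scaleA a b f : prod_scale a (prod_scale b f) = prod_scale (a * b) f.
Proof. by apply: functional_extensionality_dep => i; apply: scalerA. Qed.
Lemma prod_scale1 : left_id 1 prod_scale.
Proof. by move=> f; apply: functional_extensionality_dep => i; apply: scale1r. Qed.
Lemma prod_scaleDr : right_distributive prod_scale +%R.
Proof. by move=> a f g; apply: functional_extensionality_dep => i; apply: scalerDr. Qed.
Lemma prod_scaleDl f : {morph prod_scale^~ f : a b / a + b}.
Proof. by move=> a b; apply: functional_extensionality_dep => i; apply: scalerDl. Qed.

HB.instance Definition _ := GRing.Zmodule_isLmodule.Build R P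
  prod_scaleA prod_scale1 prod_scaleDr prod_scaleDl.

Definition prod_proj (i : I) (f : P) : N i := f i.
End ModProd.

Definition subdirect_product (R : pzRingType) (M : lmodType R)
    (I : Type) (N : I -> lmodType R) : Prop :=
  exists2 f : {linear M -> mod_prod N}, injective f
    & forall (i : I) (y : N i), exists x : M, prod_proj i (f x) = y.

Definition subdirect_product_of_simples
    (R : pzRingType) (M : lmodType R) : Prop :=
  exists (I : Type) (N : I -> lmodType R),
    (forall i, simple_module (N i)) /\ subdirect_product M N.

(* M^(I): the submodule of finitely supported families in the product. *)
Section DirectSum.
Variables (R : pzRingType) (I : Type) (M : lmodType R).
Local Notation P := (mod_prod (fun _ : I => M)).

Definition finsupp_family : {pred P} :=
  fun f : P => `[< finite_set [set i | prod_proj i f != 0] >].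

Lemma finsupp_family_closed : submod_closed finsupp_family.
Proof.
split=> [|a f g /asboolP ff /asboolP fg]; apply/asboolP.
  by rewrite (_ : [set _ | _] = set0) //; apply/seteqP; split=> i //=;
     rewrite /prod_proj eqxx.
apply: (@sub_finite_set _ _
  ([set i | prod_proj i f != 0] `|` [set i | prod_proj i g != 0])).
  move=> i /= fgi; case: (eqVneq (prod_proj i f) 0) => fi; last by left.
  case: (eqVneq (prod_proj i g) 0) => gi; last by right.
  move: fgi; rewrite (_ : prod_proj i _ = a *: prod_proj i f + prod_proj i g) //.
  by rewrite fi gi scaler0 addr0 eqxx.
by rewrite finite_setU.
Qed.

HB.instance Definition _ :=
  GRing.isSubmodClosed.Build R P finsupp_family finsupp_family_closed.

Record mod_copower : Type :=
  ModCopower { copower_val :> P; _ : copower_val \in finsupp_family }.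

HB.instance Definition _ := [isSub for copower_val].
HB.instance Definition _ := [Choice of mod_copower by <:].
HB.instance Definition _ := [SubChoice_isSubLmodule of mod_copower by <:].
End DirectSum.

Definition relatively_projective (R : pzRingType) (M L : lmodType R) : Prop :=
  forall (N : lmodType R) (p : {linear L -> N}) (f : {linear M -> N}),
    (forall y : N, exists x : L, p x = y) ->
    exists g : {linear M -> L}, forall x : M, p (g x) = f x.

(* Main.v *)
Require Import Defs.
From HB Require Import structures.
From mathcomp Require Import all_boot all_algebra.
From mathcomp Require Import boolp classical_sets cardinality.

Set Implicit Arguments.
Unset Strict Implicit.
Unset Printing Implicit Defensive.

Import GRing.Theory Quotient.
Local Open Scope ring_scope.
Local Open Scope classical_set_scope.
Local Open Scope quotient_scope.

(** M is a subdirect product of simple modules iff Rad M = 0, so it remains to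
    compare "abelian" with "quasi-duo".

    If K is maximal and fully invariant, an idempotent endomorphism e induces 0
    or 1 on the simple module M/K, so e s (1 - e) maps M into K for every
    endomorphism s. As the maximal submodules meet in 0, e s (1 - e) = 0; the
    same holds for 1 - e, so e is central.

    Conversely let K be maximal and suppose that s K is not contained in K.
    Then K + s K = M, whence K + s^-1 K = M. By the Chinese remainder theorem
    M maps onto M/K x M/(s^-1 K), and lifting (p, 0), where p : M -> M/K is the
    projection, gives an endomorphism g with (1 - g) M in K and g M in s^-1 K.
    In an abelian regular ring right ideals are two-sided, so
    s (1 - g) = (1 - g) t maps M into K, as does s g. Hence s M is contained in
    K, a contradiction. *)

Lemma range_setTP (T U : Type) (f : T -> U) :
  range f = [set: U] <-> forall y, exists x, f x = y.
Proof.
split=> [fT y|fsurj].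
  by have [x _ <-] : range f y; [rewrite fT | exists x].
by apply/seteqP; split=> // y _; have [x <-] := fsurj y; exists x.
Qed.

Section AbelianRegularRing.
Variable S : pzRingType.
Implicit Types e f s : S.

Lemma idempotent_compl e : idempotent_elt e -> idempotent_elt (1 - e).
Proof.
by move=> ee; rewrite /idempotent_elt mulrBl mul1r mulrBr mulr1 ee subrr subr0.
Qed.

Lemma abelian_ring_corner0 :
  (forall e s, idempotent_elt e -> e * s * (1 - e) = 0) -> abelian_ring S.
Proof.
move=> corner0 e ee s.
have /eqP := corner0 e s ee; rewrite mulrBr mulr1 subr_eq0 => /eqP ->.
have /eqP := corner0 (1 - e) s (idempotent_compl ee).
by rewrite subKr !mulrBl mul1r subr_eq0 => /eqP <-.
Qed.

Lemma abelian_regular_right_duo f s :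
  abelian_ring S -> von_neumann_regular S -> exists t, s * f = f * t.
Proof.
move=> abS regS; have [x fxf] := regS f.
have fx_central : central_elt (f * x).
  by apply: abS; rewrite /idempotent_elt mulrA fxf.
by exists (x * s * f); rewrite !mulrA fx_central -!mulrA [f * _]mulrA fxf.
Qed.
End AbelianRegularRing.

Section SubmoduleClosure.
Variables (R : pzRingType) (M : lmodType R).

Lemma submoduleP (K : set M) :
  submodule K <-> K 0 /\ forall a x y, K x -> K y -> K (a *: x + y).
Proof.
split=> [[K0 KZD]|[K0 KZD]].
  split=> [|a x y Kx Ky]; first exact: set_mem K0.
  by apply/set_mem/KZD; apply/mem_set.
split=> [|a x y /set_mem Kx /set_mem Ky]; apply/mem_set => //.
exact: KZD.
Qed.

Variables (K : set M) (sK : submodule K).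

(* The proof argument is what lets the closure properties of K be inferred. *)
Definition submodule_pred of submodule K : {pred M} := [in K].

HB.instance Definition _ :=
  GRing.isSubmodClosed.Build R M (submodule_pred sK)
    (sK : GRing.submod_closed (submodule_pred sK)).

Lemma submodule0 : K 0.
Proof. exact: set_mem (rpred0 (submodule_pred sK)). Qed.

Lemma submoduleD x y : K x -> K y -> K (x + y).
Proof.
move=> /mem_set Kx /mem_set Ky.
exact: set_mem (@rpredD _ (submodule_pred sK) _ _ Kx Ky).
Qed.

Lemma submoduleZ a x : K x -> K (a *: x).
Proof.
by move=> /mem_set Kx; exact: set_mem (@rpredZ _ _ (submodule_pred sK) a _ Kx).
Qed.
End SubmoduleClosure.

Definition sum_set (V : zmodType) (A B : set V) : set V :=
  [set a + b | a in A & b in B].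

Definition kernel (R : pzRingType) (M N : lmodType R) (f : {linear M -> N}) :
  set M := f @^-1` [set 0].

Section SubmoduleOperations.
Variables (R : pzRingType) (M N : lmodType R) (f : {linear M -> N}).
Implicit Types K L : set M.

Lemma submodule_sum_set K L :
  submodule K -> submodule L -> submodule (sum_set K L).
Proof.
move=> sK sL; apply/submoduleP; split.
  by exists 0; [|exists 0]; rewrite ?addr0 //; apply: submodule0.
move=> a _ _ [k Kk [l Ll <-]] [k' Kk' [l' Ll' <-]].
exists (a *: k + k'); first by apply: submoduleD => //; apply: submoduleZ.
exists (a *: l + l'); first by apply: submoduleD => //; apply: submoduleZ.
by rewrite scalerDr addrACA.
Qed.

Lemma submodule_image K : submodule K -> submodule (f @` K).
Proof.
move=> sK; apply/submoduleP; split=> [|a _ _ [x Kx <-] [y Ky <-]].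
  by exists 0; rewrite ?linear0 //; apply: submodule0.
exists (a *: x + y); last exact: linearP.
by apply: submoduleD => //; apply: submoduleZ.
Qed.

Lemma submodule_preimage (K : set N) : submodule K -> submodule (f @^-1` K).
Proof.
move=> sK; apply/submoduleP; split=> [|a x y /= Kx Ky].
  by rewrite /= linear0; apply: submodule0.
by rewrite linearP; apply: submoduleD => //; apply: submoduleZ.
Qed.

Lemma submodule_kernel : submodule (kernel f).
Proof.
apply/submodule_preimage/submoduleP.
by split=> // a x y /= -> ->; rewrite scaler0 addr0.
Qed.

Lemma kernelB x y : kernel f (x - y) <-> f x = f y.
Proof.
rewrite /kernel /= linearB.
by split=> [/eqP|->]; rewrite ?subrr // subr_eq0 => /eqP.
Qed.

Lemma sum_set_preimage K (L : set N) :
  sum_set L (f @` K) = [set: N] -> sum_set K (f @^-1` L) = [set: M].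
Proof.
move=> LfKT; apply/seteqP; split=> // x _.
have [l Ll [_ [k Kk <-] lfk]] : sum_set L (f @` K) (f x) by rewrite LfKT.
exists k => //; exists (x - k); last by rewrite addrC subrK.
by rewrite /= linearB -lfk addrK.
Qed.
End SubmoduleOperations.

Section MaximalSubmodule.
Variables (R : pzRingType) (M : lmodType R).
Implicit Types K N : set M.

Lemma maximal_sum_setT K N :
  maximal_submodule K -> submodule N -> ~ (N `<=` K) -> sum_set K N = [set: M].
Proof.
move=> [sK _ Kmax] sN NK.
have [||KNK|//] := Kmax (sum_set K N); first exact: submodule_sum_set.
  by move=> k Kk; exists k => //; exists 0; [exact: submodule0 | rewrite addr0].
case: NK; rewrite -KNK => n Nn.
by exists 0; [exact: submodule0 | exists n => //; rewrite add0r].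
Qed.

Lemma simple_maximal_kernel (N : lmodType R) (f : {linear M -> N}) :
  range f = [set: N] -> simple_module N -> maximal_submodule (kernel f).
Proof.
move=> fT [[y y_neq0] Nsimple]; split=> [|kerT|L sL kerL].
- exact: submodule_kernel.
- have [x fx] := (range_setTP f).1 fT y.
  have : kernel f x by rewrite kerT.
  by rewrite /kernel /= fx; apply/eqP.
- have [|im0|imT] := Nsimple (f @` L); first exact: submodule_image.
    left; apply/seteqP; split=> // x Lx.
    by have : (f @` L) (f x) by [exists x]; rewrite im0.
  right; apply/seteqP; split=> // x _.
  have [l Ll flx] : (f @` L) (f x) by rewrite imT.
  rewrite -(subrK l x); apply: submoduleD => //; apply: kerL.
  exact/kernelB.
Qed.

Lemma maximal_kernel_simple (N : lmodType R) (f : {linear M -> N}) :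
  range f = [set: N] -> maximal_submodule (kernel f) -> simple_module N.
Proof.
move=> fT [_ kernT kermax]; split.
  apply: contrapT => N0; apply: kernT; apply/seteqP; split=> // x _.
  by apply: contrapT => /eqP fx0; apply: N0; exists (f x).
move=> L sL; rewrite -(image_preimage L fT).
have [||->|->] := kermax (f @^-1` L); first exact: submodule_preimage.
- by move=> x; rewrite /kernel /= => ->; apply: submodule0.
- left; apply: image_preimage fT.
- by right.
Qed.
End MaximalSubmodule.

Section QuotientModule.
Variables (R : pzRingType) (M : lmodType R) (K : set M) (sK : submodule K).

Definition mod_quot : Type := {quot (submodule_pred sK)}.

HB.instance Definition _ := GRing.Zmodule.on mod_quot.

Definition mod_proj (x : M) : mod_quot := \pi_({quot (submodule_pred sK)}) x.

Lemma mod_proj_surj (q : mod_quot) : exists x, mod_proj x = q.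
Proof. by exists (repr q); apply: reprK. Qed.

Lemma mod_proj_eq x y : mod_proj x = mod_proj y <-> K (x - y).
Proof.
split=> [/eqP|Kxy].
  by rewrite /mod_proj -idealrBE => /set_mem.
by apply/eqP; rewrite /mod_proj -idealrBE; apply/mem_set.
Qed.

Lemma mod_proj_is_zmod_morphism : zmod_morphism mod_proj.
Proof. exact: (raddfB (\pi_({quot (submodule_pred sK)}))). Qed.

HB.instance Definition _ :=
  GRing.isZmodMorphism.Build M mod_quot mod_proj mod_proj_is_zmod_morphism.

Definition quot_scale (a : R) (q : mod_quot) : mod_quot :=
  mod_proj (a *: (repr q : M)).

Lemma mod_projZ a x : mod_proj (a *: x) = quot_scale a (mod_proj x).
Proof.
apply/mod_proj_eq; rewrite -scalerBr; apply: submoduleZ => //.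
by apply/mod_proj_eq; rewrite [RHS]reprK.
Qed.

Lemma quot_scaleA a b q : quot_scale a (quot_scale b q) = quot_scale (a * b) q.
Proof. by have [x <-] := mod_proj_surj q; rewrite -!mod_projZ scalerA. Qed.

Lemma quot_scale1 : left_id 1 quot_scale.
Proof.
by move=> q; have [x <-] := mod_proj_surj q; rewrite -mod_projZ scale1r.
Qed.

Lemma quot_scaleDr : right_distributive quot_scale +%R.
Proof.
move=> a q r; have [x <-] := mod_proj_surj q; have [y <-] := mod_proj_surj r.
by rewrite -raddfD -!mod_projZ -raddfD scalerDr.
Qed.

Lemma quot_scaleDl q : {morph quot_scale^~ q : a b / a + b}.
Proof.
move=> a b; have [x <-] := mod_proj_surj q.
by rewrite -!mod_projZ -raddfD scalerDl.
Qed.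

HB.instance Definition _ := GRing.Zmodule_isLmodule.Build R mod_quot
  quot_scaleA quot_scale1 quot_scaleDr quot_scaleDl.

HB.instance Definition _ :=
  GRing.isScalable.Build R M mod_quot *:%R mod_proj mod_projZ.

Lemma range_mod_proj : range mod_proj = [set: mod_quot].
Proof. exact/range_setTP/mod_proj_surj. Qed.

Lemma kernel_mod_proj : kernel mod_proj = K.
Proof.
by apply/seteqP; split=> x; rewrite -[x in K x]subr0 -mod_proj_eq linear0.
Qed.

Lemma simple_mod_quot : maximal_submodule K -> simple_module mod_quot.
Proof.
by rewrite -{1}kernel_mod_proj; apply: maximal_kernel_simple range_mod_proj.
Qed.
End QuotientModule.

Section SubdirectProduct.
Variables (R : pzRingType) (I : Type) (N : I -> lmodType R).

Lemma prod_proj_is_linear i : linear (@prod_proj R I N i).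
Proof. by []. Qed.

HB.instance Definition _ i :=
  GRing.isLinear.Build R (mod_prod N) (N i) *:%R (@prod_proj R I N i)
    (prod_proj_is_linear i).

Variable M : lmodType R.

Definition prod_map (f : forall i, {linear M -> N i}) (x : M) : mod_prod N :=
  fun i => f i x.

Lemma prod_map_is_linear f : linear (prod_map f).
Proof.
by move=> a x y; apply: functional_extensionality_dep => i; apply: linearP.
Qed.

HB.instance Definition _ f :=
  GRing.isLinear.Build R M (mod_prod N) *:%R (prod_map f)
    (prod_map_is_linear f).

Lemma subdirect_productP :
  subdirect_product M N <->
  exists2 f : forall i, {linear M -> N i},
    forall i, range (f i) = [set: N i] & \bigcap_i kernel (f i) = [set 0].
Proof.
split=> [[f finj fsurj]|[f fT kerf0]].
  exists (fun i => prod_proj i \o f) => [i|]; first exact/range_setTP/fsurj.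
  apply/seteqP; split=> [x kerx|_ -> i _]; last exact: linear0.
  apply: finj; rewrite linear0; apply: functional_extensionality_dep => i.
  exact: kerx.
exists (prod_map f) => [|i]; last exact/range_setTP/fT.
apply: raddf_inj => x fx0; rewrite -[_ = 0]/([set 0] x) -kerf0 => i _.
exact: (congr1 (prod_proj i) fx0).
Qed.
End SubdirectProduct.

Lemma subdirect_product_of_simplesP (R : pzRingType) (M : lmodType R) :
  subdirect_product_of_simples M <-> Rad M = [set 0].
Proof.
split=> [[I [N [Nsimple /subdirect_productP[f fT kerf0]]]]|Rad0].
  apply/seteqP; split=> [x Rx|_ -> K [sK _ _]]; last exact: submodule0.
  rewrite -kerf0 => i _; apply: Rx.
  exact: simple_maximal_kernel (fT i) (Nsimple i).
pose I := {K : set M | maximal_submodule K}.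
have sI (i : I) : submodule (sval i) by case: i => K [].
exists I, (fun i => mod_quot (sI i)); split=> [i|].
  exact/simple_mod_quot/(svalP i).
apply/subdirect_productP; exists (fun i => mod_proj (sI i)) => [i|].
  exact: range_mod_proj.
rewrite -Rad0; apply/seteqP; split=> [x kerx K mK|x Rx i _].
  by have := kerx (exist _ K mK); rewrite kernel_mod_proj; apply.
by rewrite kernel_mod_proj; exact: Rx (svalP i).
Qed.

Section RelativeProjectivity.
Variables (R : pzRingType) (M : lmodType R).

Lemma relatively_projective_epi (L L' : lmodType R) (h : {linear L -> L'}) :
  range h = [set: L'] ->
  relatively_projective M L -> relatively_projective M L'.
Proof.
move=> /range_setTP hsurj projL N p f psurj.
have [y|g pg] := projL N (p \o h) f; last by exists (h \o g).
by have [x <-] := psurj y; have [z <-] := hsurj x; exists z.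
Qed.

Section CopowerCoordinate.
Variables (I : Type) (L : lmodType R) (i : I).

Definition copower_coord (u : mod_copower I L) : L := prod_proj i (val u).

Lemma copower_coord_is_linear : linear copower_coord.
Proof. by []. Qed.

HB.instance Definition _ :=
  GRing.isLinear.Build R (mod_copower I L) L *:%R copower_coord
    copower_coord_is_linear.

Lemma range_copower_coord : range copower_coord = [set: L].
Proof.
apply/range_setTP => x.
pose delta : mod_prod (fun _ : I => L) :=
  fun j => if `[< j = i >] then x else 0.
have delta_fin : delta \in @finsupp_family R I L.
  apply/asboolP/(sub_finite_set _ (finite_set1 i)) => j /=.
  by rewrite /prod_proj /delta; case: asboolP => // _; rewrite eqxx.
exists (ModCopower delta_fin).
by rewrite /copower_coord /prod_proj /= /delta asboolT.
Qed.
End CopowerCoordinate.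

Lemma relatively_projective_copower (I : Type) (L : lmodType R) (i : I) :
  relatively_projective M (mod_copower I L) -> relatively_projective M L.
Proof. exact/relatively_projective_epi/(range_copower_coord _ i). Qed.
End RelativeProjectivity.

Section ChineseRemainder.
Variables (R : pzRingType) (M N1 N2 : lmodType R).
Implicit Types (f : {linear M -> N1}) (g : {linear M -> N2}).

Definition pair_map f g (x : M) : N1 * N2 := (f x, g x).

Lemma pair_map_is_linear f g : linear (pair_map f g).
Proof. by move=> a x y; rewrite /pair_map !linearP. Qed.

HB.instance Definition _ f g :=
  GRing.isLinear.Build R M (N1 * N2)%type *:%R (pair_map f g)
    (pair_map_is_linear f g).

Lemma range_pair_map f g :
  range f = [set: N1] -> range g = [set: N2] ->
  sum_set (kernel f) (kernel g) = [set: M] ->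
  range (pair_map f g) = [set: N1 * N2].
Proof.
move=> /range_setTP fsurj /range_setTP gsurj kerT; apply/range_setTP => -[y z].
have [a <-] := fsurj y; have [b <-] := gsurj z.
have [k fk0 [l gl0 kl_ab]] : sum_set (kernel f) (kernel g) (a - b).
  by rewrite kerT.
exists (a - k); congr pair; first by rewrite linearB fk0 subr0.
by apply/kernelB; rewrite addrAC -kl_ab addrAC subrr add0r.
Qed.
End ChineseRemainder.

Section Endomorphisms.
Variables (R : pzRingType) (M : lmodType R).
Implicit Types (A B K : set M) (e f g s : endring M).

Lemma self_projective_split A B :
  relatively_projective M M -> submodule A -> submodule B ->
  sum_set A B = [set: M] ->
  exists g, range (1 - g : endring M) `<=` A /\ range g `<=` B.
Proof.
move=> projM sA sB ABT; pose pA := mod_proj sA; pose pB := mod_proj sB.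
have pT : range (pair_map pA pB) = setT.
  by apply: range_pair_map; rewrite ?range_mod_proj ?kernel_mod_proj.
have [|g pg] := projM _ (pair_map pA pB) (pair_map pA \0).
  exact/range_setTP.
exists g; split=> _ [x _ <-]; have [pAg pBg] := pg x.
  exact/(mod_proj_eq sA)/esym.
by rewrite -[B](kernel_mod_proj sB).
Qed.

Lemma idempotent_range_maximal K e :
  maximal_submodule K -> fully_invariant K -> idempotent_elt e ->
  range e `<=` K \/ range (1 - e : endring M) `<=` K.
Proof.
move=> [sK _ Kmax] Kinv ee; have [||eK|eT] := Kmax (e @^-1` K).
- exact: submodule_preimage.
- by move=> x Kx; apply: (Kinv e); exists x.
- have ee1 : e * (1 - e) = 0 by rewrite mulrBr mulr1 ee subrr.
  right=> _ [x _ <-]; rewrite -eK -[_ _]/(K ((e * (1 - e)) x)) ee1.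
  exact: submodule0.
- by left=> _ [x _ <-]; have : (e @^-1` K) x by rewrite eT.
Qed.

Lemma quasi_duo_abelian :
  quasi_duo M -> Rad M = [set 0] -> abelian_ring (endring M).
Proof.
move=> qd Rad0; apply: abelian_ring_corner0 => e s ee.
apply: endring_ext => x.
suff: Rad M ((e * s * (1 - e)) x) by rewrite Rad0.
move=> K mK; have Kinv := qd K mK.
have [eK|eK] := idempotent_range_maximal mK Kinv ee; first by apply: eK.
apply: (Kinv (e * s)); exists ((1 - e : endring M) x) => //.
by apply: eK; exists x.
Qed.

Lemma abelian_endoregular_quasi_duo :
  relatively_projective M M -> abelian_endoregular M -> quasi_duo M.
Proof.
move=> projM [abE regE] K mK s; have [sK _ _] := mK.
apply: contrapT => sK_notin_K.
have K_sVK : sum_set K (s @^-1` K) = [set: M].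
  by apply/sum_set_preimage/maximal_sum_setT => //; apply: submodule_image.
have sVK := submodule_preimage s sK.
have [g [compl_gK gsVK]] := self_projective_split projM sK sVK K_sVK.
have [t s_compl_g] :=
  abelian_regular_right_duo (1 - g) (s : endring M) abE regE.
case: sK_notin_K => _ [x _ <-]; rewrite -[x](subrK (g x)) linearD.
apply: submoduleD => //; last by apply: gsVK; exists x.
have -> : s (x - g x) = ((1 - g) * t) x by rewrite -s_compl_g.
by apply: compl_gK; exists (t x).
Qed.
End Endomorphisms.

Theorem theorem3p6 (R : pzRingType) (M : rmodType R) :
  let cond1 :=
    quasi_duo M /\ endoregular M /\ subdirect_product_of_simples M in
  let cond2 := abelian_endoregular M /\ Rad M = [set 0%R]%classic in
  (cond1 -> cond2) /\
  ((forall I : Type, relatively_projective M (mod_copower I M)) ->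
   (cond1 <-> cond2)).
Proof.
move=> cond1 cond2.
have cond12 : cond1 -> cond2.
  move=> [qd [reg /subdirect_product_of_simplesP Rad0]].
  by split=> //; split=> //; apply: quasi_duo_abelian.
split=> // projM; split=> // -[abM Rad0].
have self_projM := relatively_projective_copower tt (projM unit).
split; first exact: abelian_endoregular_quasi_duo.
by split; [case: abM | apply/subdirect_product_of_simplesP].
Qed.
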